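(* Let $k$ and $m$ be positive integers and fix one of the four directions: from below, from above, from the right, from the left. For any semi-online algorithm that $k$-colours bottomless rectangles presented from that direction, there is a finite family of bottomless rectangles such that, when the family is presented to the algorithm from that direction, the algorithm will produce (at some step) an $m$-fold covered point that is covered by at most one colour.
   Context: A (closed) bottomless rectangle is a subset of $\mathbb{R}^2$ of the form $\{(x,y): l\le x\le r,\ y\le t\}$; it is denoted by its parameters $(l,r,t)$, where $l$ is its left-coordinate, $r$ its right-coordinate and $t$ its height. Presenting the rectangles of a finite family from below (resp. from above) means in increasing (resp. decreasing) order of height $t$; from the left means in increasing order of left-coordinate $l$; from the right means in decreasing order of right-coordinate $r$. A semi-online $k$-colouring algorithm receives the rectangles one by one in the given order, without knowledge of the rectangles still to come. After each new rectangle it may assign one of $k$ colours to any of the so far presented, not yet coloured rectangles (it may leave rectangles uncoloured and colour them at a later step); colours are irrevocable. So after every step there is a partial $k$-colouring of the rectangles presented so far, determined by the sequence presented so far, and each partial colouring extends the previous one. The algorithm's condition is required to hold for the partial colouring at every step, with respect to the rectangles presented so far. A point is $m$-fold covered (at a step) if it lies in at least $m$ of the rectangles presented so far. It is covered by a colour if it lies in a presented rectangle that currently has that colour; uncoloured rectangles contribute no colour. *)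

(* Defs.v *)
From HB Require Import structures.
From mathcomp Require Import all_boot all_order all_algebra.
From mathcomp Require Import reals.

Set Implicit Arguments.
Unset Strict Implicit.
Unset Printing Implicit Defensive.

Import Order.TTheory GRing.Theory Num.Theory.
Local Open Scope ring_scope.

(* A closed bottomless rectangle is given by its parameters [(l, r, t)], with
   [l <= r], i.e. the point set [{(x, y) | l <= x <= r, y <= t}] is nonempty. *)
Record brect (R : realType) := BRect {
  params : R * R * R;
  _ : params.1.1 <= params.1.2
}.

HB.instance Definition _ (R : realType) := [isSub for @params R].
HB.instance Definition _ (R : realType) := [Choice of brect R by <:].

Definition left_coord (R : realType) (B : brect R) : R := (params B).1.1.
Definition right_coord (R : realType) (B : brect R) : R := (params B).1.2.
Definition height (R : realType) (B : brect R) : R := (params B).2.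

Coercion pred_of_brect (R : realType) (B : brect R) : {pred R * R} :=
  [pred p | (left_coord B <= p.1 <= right_coord B) && (p.2 <= height B)].

Inductive direction := FromBelow | FromAbove | FromRight | FromLeft.

Definition precedes (R : realType) (d : direction) : rel (brect R) :=
  fun A B => match d with
  | FromBelow => height A < height B
  | FromAbove => height B < height A
  | FromRight => right_coord B < right_coord A
  | FromLeft => left_coord A < left_coord B
  end.

(* The order is strict: a presented family has pairwise distinct relevant
   coordinates, so it is duplicate-free and its presentation is unique. *)
Definition presented (R : realType) (d : direction) (s : seq (brect R)) : bool :=
  sorted (precedes d) s.

(* [colouring alg s B] is the colour of [B] (or [None] if [B] is uncoloured)
   after the sequence [s] has been presented; it is meaningful only when
   [presented d s] and [B \in s], so nothing is required of other values. *)
Record semi_online (R : realType) (d : direction) (k : nat) := SemiOnline {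
  colouring :> seq (brect R) -> brect R -> option 'I_k;
  colouring_irrevocable : forall s A B c,
    presented d (rcons s A) -> B \in s ->
    colouring s B = Some c -> colouring (rcons s A) B = Some c
}.

Definition fold_covered (R : realType) (m : nat) (s : seq (brect R))
    (p : R * R) : bool :=
  (m <= count (fun B : brect R => p \in B) s)%N.

Definition covering_colours (R : realType) (k : nat) (s : seq (brect R))
    (f : brect R -> option 'I_k) (p : R * R) : {set 'I_k} :=
  [set c | has (fun B : brect R => (p \in B) && (f B == Some c)) s].

(* Main.v *)
Require Import Defs.
From mathcomp Require Import all_boot all_order all_algebra.
From mathcomp Require Import boolp reals.
From mathcomp Require Import zify.

Set Implicit Arguments.
Unset Strict Implicit.
Unset Printing Implicit Defensive.

Import Order.TTheory GRing.Theory Num.Theory.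

(** The adversary only needs nested intervals. It presents intervals of time:
    the one presented at step i is [a_i, i] with a_i <= i, and the family stays
    laminar, so it is a forest presented from the leaves to the roots in
    postorder: a new interval becomes the root over a final segment of the
    current trees. In each of the four directions the interval [a, u] can be
    realised by a bottomless rectangle, and the time w by a point, such that the
    point lies in the rectangle iff a <= w <= u (interval_model). The rectangles
    over the point of a vertex w are then exactly the vertices on the path from
    w up to its root (mem_chain), so it suffices to force long paths ending in
    a root on which at most one colour is used (mono_chain_exists).

    Let the type of depth n + 1 of a vertex be its current colour (possibly
    none) together with the set of types of depth n of its children. For a given
    depth there are finitely many types. The heart of the proof is
    type_descent: if a vertex v has now the type that one of its children w had
    at an earlier time, then w has now the type, one level shallower, that one of
    the children of w had at that time, and so on downwards. Along the resulting
    path v, w, w1, ... each new colour is the old colour of the next vertex.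
    Colours are irrevocable, so once a colour occurs on this path it is repeated
    at every later vertex: the path is uncoloured down to some vertex and has a
    single colour from there on.

    Hence, as long as the algorithm resists, a new root never takes, then or
    later, a type that one of its children had when the root was presented. This
    lets the adversary produce more and more types, which is absurd
    (many_types). The difficulty is that types change when the algorithm colours
    old vertices. It is met by the lemma settle: since only finitely many
    vertices lie below a given one, the adversary can continue in such a way
    that their colours change no more, whatever it presents afterwards to the
    right of them. Suppose that n types can always be realised by settled roots.
    Realise n types, then n types again to the right. If the two sets of types
    differ, there are already n + 1 types. Otherwise put a root over the second
    group and settle it: its type is not among the n types of this group, and
    these are still realised by the first group. *)

(** * Laminar families of intervals presented in postorder *)

(** A sequence s of left ends stands for the presented intervals [s_i, i]; the
    right end is the time of presentation. *)
Definition lft (s : seq nat) (i : nat) : nat := nth 0 s i.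

Definition laminar (s : seq nat) : Prop :=
  forall i, i < size s ->
    lft s i <= i /\ forall j, lft s i <= j <= i -> lft s i <= lft s j.

(** Later intervals leave the old ones untouched: they lie to the right of the
    vertices of s. Play below a future root is therefore a growth of the position
    from which that root starts. *)
Definition grows (s t : seq nat) : Prop :=
  [/\ laminar t, prefix s t &
      forall i, size s <= i < size t -> size s <= lft t i].

(** The vertices w of [x, n) that are roots once only the intervals presented
    before time n, and starting at x or later, are kept. It describes at once the
    roots of a block of the forest and the children of a vertex. *)
Definition maximal (s : seq nat) (x n w : nat) : bool :=
  (x <= w < n) && [forall u : 'I_n, (w < u) ==> (w < lft s u)].

Definition child (s : seq nat) : rel nat :=
  fun v w => maximal s (lft s v) v w.

Lemma maximalP s x n w :
  reflect (x <= w < n /\ forall u, w < u < n -> w < lft s u)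
          (maximal s x n w).
Proof.
apply: (iffP andP) => -[wn maxw]; split=> //.
  move=> u /andP[wu un].
  by have /forallP/(_ (Ordinal un))/implyP := maxw; apply.
by apply/forallP => u; apply/implyP => wu; apply: maxw; rewrite wu ltn_ord.
Qed.

Lemma maximal_lt s x n w : maximal s x n w -> x <= w < n.
Proof. by case/andP. Qed.

Lemma lft_prefix s t i : prefix s t -> i < size s -> lft t i = lft s i.
Proof. by case/prefixP=> r -> lt_i; rewrite /lft nth_cat lt_i. Qed.

Lemma lft_rcons_last s x : lft (rcons s x) (size s) = x.
Proof. by rewrite /lft nth_rcons ltnn eqxx. Qed.

Lemma prefix_size_leq (s t : seq nat) : prefix s t -> size s <= size t.
Proof. by case/prefixP=> r ->; rewrite size_cat leq_addr. Qed.

Lemma maximal_prefix s t x n w :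
  prefix s t -> n <= size s -> maximal t x n w = maximal s x n w.
Proof.
move=> st le_n; congr (_ && _); apply: eq_forallb => u.
by rewrite (lft_prefix st) // (leq_trans (ltn_ord u)).
Qed.

Lemma child_prefix s t v w :
  prefix s t -> v < size s -> child t v w = child s v w.
Proof.
by move=> st lt_v; rewrite /child (lft_prefix st) // (maximal_prefix _ _ st) 1?ltnW.
Qed.

Lemma grows_refl s : laminar s -> grows s s.
Proof. by move=> lam; split=> // [|i]; [exact: prefix_refl | lia]. Qed.

Lemma grows_trans s t u : grows s t -> grows t u -> grows s u.
Proof.
move=> [_ st newt] [lamu tu newu]; split=> // [|i /andP[si iu]].
  exact: prefix_trans st tu.
have st_size := prefix_size_leq st.
have [it|ti] := ltnP i (size t).
  by rewrite (lft_prefix tu) // newt ?si.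
by apply: leq_trans (newu i _); rewrite ?ti.
Qed.

(** The basic move of the adversary: the new root covers everything presented
    since s, and nothing else. *)
Lemma grows_close s t : grows s t -> grows s (rcons t (size s)).
Proof.
move=> [lamt st newt]; have le_st := prefix_size_leq st.
have pre : prefix t (rcons t (size s)) by exact: prefix_rcons.
have lftE i : i < size t -> lft (rcons t (size s)) i = lft t i.
  exact: lft_prefix.
split=> [i|| i].
- rewrite size_rcons ltnS leq_eqVlt => /predU1P[->|lt_i].
    rewrite lft_rcons_last; split=> // j /andP[sj].
    rewrite leq_eqVlt => /predU1P[->|lt_j]; first by rewrite lft_rcons_last.
    by rewrite lftE // newt ?sj.
  have [le_i lam_i] := lamt i lt_i; rewrite lftE //; split=> // j /andP[ij ji].
  by rewrite lftE ?(leq_ltn_trans ji) // lam_i ?ij.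
- exact: prefix_trans st pre.
- rewrite size_rcons ltnS => /andP[si].
  rewrite leq_eqVlt => /predU1P[->|lt_i]; first by rewrite lft_rcons_last.
  by rewrite lftE // newt ?si.
Qed.

Lemma maximal_grows s t x w :
  grows s t -> maximal s x (size s) w -> maximal t x (size t) w.
Proof.
move=> [_ st newt] /maximalP[/andP[xw ws] maxw].
have le_st := prefix_size_leq st.
apply/maximalP; rewrite xw (leq_trans ws) //; split=> // u /andP[wu ut].
have [us|su] := ltnP u (size s); first by rewrite (lft_prefix st) // maxw ?wu.
by apply: leq_trans ws (newt _ _); rewrite su.
Qed.

(** The last vertex of a descending path is covered by the path and by nothing
    else below its top: an interval presented between a child and its parent
    starts after the child. *)
Lemma mem_chain s v p : laminar s -> v < size s -> path (child s) v p ->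
  forall u, (u \in v :: p) = (lft s u <= last v p <= u) && (u <= v).
Proof.
move=> lam; elim: p v => [|w p IHp] v lt_v /=.
  move=> _ u; rewrite inE; have [le_v _] := lam v lt_v.
  by apply/eqP/idP => [->|]; lia.
case/andP=> /maximalP[vw btw] pw u.
have lt_w : w < size s by lia.
have IHw := IHp w lt_w pw.
have := IHw w; rewrite mem_head => /esym covw.
have [_ /(_ w)] := lam v lt_v; have := btw u.
rewrite inE IHw; have [->|neq_u /=] := eqVneq u v; lia.
Qed.

Lemma chain_uniq s v p : path (child s) v p -> uniq (v :: p).
Proof.
move=> pv; apply: (@sorted_uniq _ (fun a b => b < a)) => /=.
- by move=> a b c; lia.
- by move=> a; rewrite ltnn.
by apply: sub_path pv => a b /maximalP[/andP[]].
Qed.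

(** * Types of vertices *)

Section Types.
Variable k : nat.

Fixpoint typ (n : nat) : finType :=
  if n is n'.+1 then (option 'I_k * {set typ n'})%type : finType
  else unit : finType.

Variable col : seq nat -> nat -> option 'I_k.
Hypothesis col_rcons : forall s a v c,
  v < size s -> col s v = Some c -> col (rcons s a) v = Some c.

Lemma col_prefix s t v c :
  prefix s t -> v < size s -> col s v = Some c -> col t v = Some c.
Proof.
case/prefixP=> r -> lt_v colv; elim/last_ind: r => [|r a IHr]; first by rewrite cats0.
by rewrite -rcons_cat; apply: col_rcons => //; rewrite size_cat ltn_addr.
Qed.

Fixpoint vtype (n : nat) (s : seq nat) (v : nat) : typ n :=
  if n is n'.+1 return typ n then
    (col s v, [set vtype n' s w | w : 'I_v & child s v w])
  else tt.

Lemma eq_vtype n s t v : prefix s t -> v < size s ->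
  (forall i, i <= v -> col t i = col s i) -> vtype n t v = vtype n s v.
Proof.
move=> st; elim: n v => [//|n IHn] v lt_v eqcol /=.
rewrite eqcol //; congr (_, _); apply/setP=> x.
have E : forall w : 'I_v, vtype n t w = vtype n s w.
  move=> w; apply: IHn => [|i le_i]; first by apply: ltn_trans lt_v.
  by apply: eqcol; apply: leq_trans le_i (ltnW _).
by apply/imsetP/imsetP => -[w]; rewrite inE => cw ->; exists w => //;
  rewrite ?inE ?E // ?(child_prefix _ st) // -?(child_prefix _ st).
Qed.

(** A colour read at v in t was the colour of w in s, hence it is still the colour
    of w in t; by induction it goes down the whole path. Above the first coloured
    vertex the path is uncoloured. *)
Lemma type_descent n s t v w : prefix s t -> w < size s -> child t v w ->
    vtype n.+1 t v = vtype n.+1 s w ->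
  exists p, [/\ size p = n, path (child t) v p &
    exists o, forall u, u \in v :: p -> col t u = None \/ col t u = o].
Proof.
move=> st; elim: n v w => [|n IHn] v w lt_w vw.
  exists [::]; split=> //; exists (col t v) => u.
  by rewrite inE => /eqP->; right.
case=> colE /setP typesE.
have lt_wv : w < v by case/maximalP: (vw) => /andP[].
have : vtype n.+1 t w \in [set vtype n.+1 s w0 | w0 : 'I_w & child s w w0].
  rewrite -[_ \in _]typesE; apply/imsetP; exists (Ordinal lt_wv) => //.
  by rewrite inE.
case/imsetP=> w1; rewrite inE => ww1 typeE.
have [||p [sz_p pw [o monop]]] := IHn w w1 _ _ typeE.
- exact: ltn_trans lt_w.
- by rewrite (child_prefix _ st).
exists (w :: p); split; rewrite /= ?sz_p ?vw //.
exists o => u; rewrite inE => /predU1P[->|]; last exact: monop.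
case colv: (col t v) => [c|]; [right | by left].
have colw : col t w = Some c by apply: (col_prefix st); rewrite // -colE.
by case: (monop w (mem_head _ _)); rewrite colw.
Qed.

(** * Forcing many types *)

Definition settled (s : seq nat) (n : nat) : Prop :=
  forall t, grows s t -> forall i, i < n -> col t i = col s i.

(** Growths that colour further vertices can be iterated only as often as there
    are uncoloured vertices below n. *)
Lemma settle s n : n <= size s -> laminar s ->
  exists2 t, grows s t & settled t n.
Proof.
pose blank s := [set i : 'I_n | col s i == None].
have [b] := ubnP #|blank s|; elim: b s => [//|b IHb] s lt_b le_n lam.
have [[t [i [st lt_i neq_i]]]|none] :=
    EM (exists t i, [/\ grows s t, i < n & col t i <> col s i]); last first.
  exists s; first exact: grows_refl.
  move=> t st i lt_i; apply: contrapT => neq_i.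
  by apply: none; exists t, i.
have [lamt pre _] := st.
have persist j c : j < n -> col s j = Some c -> col t j = Some c.
  by move=> lt_j; apply: col_prefix => //; exact: leq_trans le_n.
have blank_i : col s i = None.
  by case coli: (col s i) => [c|//]; case: neq_i; rewrite coli (persist _ c).
have [||u tu setu] := IHb t _ _ lamt.
- rewrite -ltnS; apply: leq_trans lt_b; rewrite ltnS; apply: proper_card.
  apply/properP; split.
    apply/subsetP=> j; rewrite !inE; case colj: (col s j) => [c|//].
    by rewrite (persist _ c).
  exists (Ordinal lt_i); rewrite inE /= ?blank_i //.
  by apply/negP => /eqP colt; apply: neq_i; rewrite colt.
- exact: leq_trans (prefix_size_leq pre).
by exists u => //; apply: grows_trans tu.
Qed.

(** Settledness up to w freezes the whole subtree of w, because descendants are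
    presented earlier; so realised types survive any growth. *)
Definition realised (n : nat) (s t : seq nat) (A : {set typ n}) : Prop :=
  forall x, x \in A -> exists w,
    [/\ maximal t (size s) (size t) w, settled t w.+1 & vtype n t w = x].

Lemma realised_grows n s t t' A :
  grows t t' -> @realised n s t A -> realised s t' A.
Proof.
move=> tt' realA x /realA[w [maxw setw typew]]; exists w; split.
- exact: maximal_grows maxw.
- move=> u t'u i lt_i.
  by rewrite (setw _ (grows_trans tt' t'u)) // (setw _ tt').
have [_ pre _] := tt'; have /andP[_ lt_w] := maximal_lt maxw.
by rewrite -typew; apply: eq_vtype => // i le_i; apply: setw.
Qed.

Lemma realised_block n s s' t A :
  size s <= size s' -> @realised n s' t A -> realised s t A.
Proof.
move=> le_s realA x /realA[w [/maximalP[lt_w maxw] setw typew]].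
exists w; split=> //; apply/maximalP; split=> //.
by case/andP: lt_w => /(leq_trans le_s)->.
Qed.

(** What the adversary aims at: a path ending in a root of the forest, with at
    most one colour besides uncoloured vertices. *)
Definition mono_chain (m : nat) : Prop :=
  exists s v p, [/\ laminar s, maximal s 0 (size s) v, path (child s) v p,
    size p = m & exists o, forall u, u \in v :: p -> col s u = None \/ col s u = o].

(** The number of types realised to the right of a position can be made
    arbitrarily large. It is essential that s is arbitrary: it allows the second
    realisation to be placed to the right of the first one. *)
Lemma many_types m n s : laminar s -> ~ mono_chain m ->
  exists t (A : {set typ m.+1}), [/\ grows s t, n <= #|A| & realised s t A].
Proof.
move=> lam nochain; elim: n s lam => [|n IHn] s lam.
  exists s, set0; split=> // [|x]; last by rewrite inE.
  exact: grows_refl.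
have [t1 [A1 [st1 cardA1 realA1]]] := IHn s lam.
have [lam1 pre1 _] := st1.
have [t2 [A2 [t12 cardA2 realA2]]] := IHn t1 lam1.
have [lam2 pre2 _] := t12.
have le_st1 := prefix_size_leq pre1.
have [big|small] := ltnP n #|A1 :|: A2|.
  exists t2, (A1 :|: A2); split=> //; first exact: grows_trans t12.
  move=> x /setUP[/(realised_grows t12 realA1)//|].
  exact: (realised_block le_st1 realA2).
(* Both sets are contained in a set with at most n elements. *)
have A12 : A1 = A2.
  have /eqP -> : A1 == A1 :|: A2.
    by rewrite eqEcard subsetUl (leq_trans small).
  by apply/esym/eqP; rewrite eqEcard subsetUr (leq_trans small).
(* Put a root v over the second group only; the first group still realises A1. *)
pose t3 := rcons t2 (size t1).
have t13 : grows t1 t3 by exact: grows_close.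
have [lam3 _ _] := t13.
have [t4 t34 set4] := settle (leqnn (size t3)) lam3.
have [lam4 pre34 _] := t34; have t14 := grows_trans t13 t34.
pose v := size t2.
have lt_v : v < size t3 by rewrite size_rcons.
have lft_v : lft t3 v = size t1 by exact: lft_rcons_last.
have pre23 : prefix t2 t3 by exact: prefix_rcons.
have maxv x : x <= v -> maximal t4 x (size t4) v.
  move=> le_x; apply: (maximal_grows t34); apply/maximalP.
  by rewrite le_x lt_v; split=> // u; rewrite size_rcons; rewrite /v; lia.
have newtype : vtype m.+1 t4 v \notin A1.
  rewrite A12; apply/negP => /realA2[w [maxw _ typew]]; apply: nochain.
  have /andP[_ lt_w] := maximal_lt maxw.
  have vw : child t4 v w.
    by rewrite (child_prefix _ pre34) // /child lft_v (maximal_prefix _ _ pre23).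
  have [p [sz_p pv monop]] :=
    type_descent (prefix_trans pre23 pre34) lt_w vw (esym typew).
  by exists t4, v, p; split=> //; exact: maxv.
exists t4, (vtype m.+1 t4 v |: A1); split.
- exact: grows_trans t14.
- by rewrite cardsU1 newtype.
move=> x /setU1P[->|/(realised_grows t14 realA1)//].
exists v; split=> //.
- by apply: maxv; apply: leq_trans le_st1 (prefix_size_leq pre2).
- by move=> u t4u i lt_i; apply: set4 t4u _ _; apply: leq_trans lt_i lt_v.
Qed.

Lemma mono_chain_exists m : mono_chain m.
Proof.
apply: contrapT => nochain.
have [|t [A [_ cardA _]]] := @many_types m #|typ m.+1|.+1 [::] _ nochain.
  by [].
by have := max_card (mem A); rewrite leqNgt cardA.
Qed.

End Types.

(** * Realisation by bottomless rectangles *)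

Local Open Scope ring_scope.

(** From below and from above, the interval [a, u] is the horizontal side and a low
    point is tested; the heights only have to follow the order of presentation.
    From the left and from the right, all the tested points lie on the side of the
    origin where the monotone coordinate imposes no condition, and the two other
    sides express a <= w and w <= u. The decreasing sequence 1 / (n + 1) leaves room
    for arbitrarily many steps. *)
Lemma interval_model (R : realType) (d : direction) :
  exists (rect : nat -> nat -> brect R) (pt : nat -> R * R),
    (forall a b u v, (u < v)%N -> precedes d (rect a u) (rect b v)) /\
    (forall a u w, (a <= u)%N -> (pt w \in rect a u) = (a <= w <= u)%N).
Proof.
pose inv n : R := n.+1%:R^-1.
have inv_gt0 n : 0 < inv n by rewrite invr_gt0 ltr0Sn.
have le_inv m n : (inv m <= inv n) = (n <= m)%N.
  by rewrite lef_pV2 ?posrE ?ltr0Sn // ler_nat ltnS.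
have lt_inv m n : (inv m < inv n) = (n < m)%N by rewrite ltNge le_inv -ltnNge.
have le_max a u : a%:R <= (maxn a u)%:R :> R by rewrite ler_nat leq_maxl.
have le_inv_opp a u : - inv a <= inv u.
  by apply: le_trans (ltW (inv_gt0 u)); rewrite oppr_le0 ltW.
case: d.
- exists (fun a u => @BRect _ (a%:R, (maxn a u)%:R, u%:R) (le_max a u)).
  exists (fun w => (w%:R, 0)); split=> [a b u v uv|a u w au].
    by rewrite /precedes /height /= ltr_nat.
  by rewrite inE /left_coord /right_coord /height /= !ler_nat ler0n andbT; lia.
- exists (fun a u => @BRect _ (a%:R, (maxn a u)%:R, inv u) (le_max a u)).
  exists (fun w => (w%:R, 0)); split=> [a b u v uv|a u w au].
    by rewrite /precedes /height /= lt_inv.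
  by rewrite inE /left_coord /right_coord /height /= !ler_nat ltW // andbT; lia.
- exists (fun a u => @BRect _ (- inv a, inv u, u%:R) (le_inv_opp a u)).
  exists (fun w => (- inv w, w%:R)); split=> [a b u v uv|a u w au].
    by rewrite /precedes /right_coord /= lt_inv.
  rewrite inE /left_coord /right_coord /height /= lerN2 le_inv ler_nat.
  by rewrite le_inv_opp andbT.
- exists (fun a u => @BRect _ (- inv u, inv a, u%:R) (le_inv_opp u a)).
  exists (fun w => (inv w, w%:R)); split=> [a b u v uv|a u w au].
    by rewrite /precedes /left_coord /= ltrN2 lt_inv.
  by rewrite inE /left_coord /right_coord /height /= le_inv_opp le_inv ler_nat.
Qed.

Theorem theorem1p3 (R : realType) (k m : nat) (hk : (0 < k)%N) (hm : (0 < m)%N)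
    (d : direction) (alg : semi_online R d k) :
  exists s : seq (brect R), presented d s /\
    exists i : nat, (i <= size s)%N /\
      exists p : R * R,
        fold_covered m (take i s) p /\
        (#|covering_colours (take i s) (alg (take i s)) p| <= 1)%N.
Proof.
have [rect [pt [rect_precedes mem_rect]]] := interval_model R d.
pose rects s := mkseq (fun i => rect (lft s i) i) (size s).
have rects_rcons s a : rects (rcons s a) = rcons (rects s) (rect a (size s)).
  rewrite /rects size_rcons mkseqS lft_rcons_last; congr rcons.
  apply/eq_in_map => i; rewrite mem_iota => /= lt_i.
  by rewrite (lft_prefix (prefix_rcons _ _)).
have presented_rects s : presented d (rects s).
  rewrite /presented sorted_map.
  by apply: sub_sorted (iota_ltn_sorted 0 _) => u v; exact: rect_precedes.
pose col s v := alg (rects s) (rect (lft s v) v).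
have col_rcons s a v c :
    (v < size s)%N -> col s v = Some c -> col (rcons s a) v = Some c.
  move=> lt_v colv.
  rewrite /col (lft_prefix (prefix_rcons _ _)) // rects_rcons.
  apply: colouring_irrevocable colv; first by rewrite -rects_rcons.
  by apply/mapP; exists v; rewrite ?mem_iota.
have [t [v [p [lam maxv pv sz_p [o mono]]]]] := mono_chain_exists col_rcons m.
have /maximalP[/andP[_ lt_v] btw] := maxv.
have chainE := mem_chain lam lt_v pv.
have lt_chain u : u \in v :: p -> (u < size t)%N.
  by rewrite chainE => /andP[_ /leq_ltn_trans]; apply.
have mem_rect_chain u : (u < size t)%N ->
    (pt (last v p) \in rect (lft t u) u) = (u \in v :: p).
  move=> lt_u; have [le_u _] := lam u lt_u.
  (* Vertices presented after the root v start to its right. *)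
  rewrite mem_rect // chainE.
  have := chainE v; rewrite mem_head; have := btw u; lia.
exists (rects t); split=> //; exists (size (rects t)); split=> //.
rewrite take_size; exists (pt (last v p)); split.
  rewrite /fold_covered count_map; apply: (@leq_trans (size (v :: p))).
    by rewrite /= sz_p.
  rewrite -size_filter; apply: uniq_leq_size; first exact: chain_uniq pv.
  move=> u chain_u; rewrite mem_filter /= mem_iota /= add0n lt_chain //.
  by rewrite mem_rect_chain ?lt_chain // chain_u.
suff sub : covering_colours (rects t) (alg (rects t)) (pt (last v p))
    \subset [set c | o == Some c].
  apply: leq_trans (subset_leq_card sub) _.
  case: o {mono sub} => [c|]; last first.
    by rewrite (_ : [set _ | _] = set0) ?cards0 //; apply/setP=> x; rewrite !inE.
  rewrite (_ : [set _ | _] = [set c]) ?cards1 //; apply/setP=> x.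
  by rewrite !inE eq_sym.
apply/subsetP => c; rewrite !inE => /hasP[B /mapP[u]].
rewrite mem_iota => /= lt_u ->{B} /andP[].
rewrite mem_rect_chain // => chain_u /eqP colu.
by have [|<-] := mono u chain_u; rewrite /col colu.
Qed.
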